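(* Let $(\Gamma,X,\mathcal B)\in\mathcal G$. Let $\mathcal S=\{\mathfrak s(B,\Gamma_{\mathcal B}(\mathfrak v)):B\in\mathcal B,\mathfrak v\in B\}$. Then $\mathcal S$ is an $X$-symmetric orbit on $St^r(\Gamma_{\mathcal B})$, where $r=|\Gamma_{\mathcal B}(\mathfrak v)|$ is constant. Let $$\Theta=\{(\mathfrak l,\mathfrak r):\mathfrak l=\mathfrak s(B,\Gamma_{\mathcal B}(\mathfrak v)),\ \mathfrak r=\mathfrak s(C,\Gamma_{\mathcal B}(\mathfrak u)),\ \mathfrak v\in B\in\mathcal B,\ \mathfrak u\in C\in\mathcal B,\ (\mathfrak v,\mathfrak u)\in Arc(\Gamma)\}.$$ Then $\Theta$ is a self-paired $X$-symmetric orbit on $DSt^r(\Gamma_{\mathcal B})$ with $St(\Theta)=\mathcal S$ and $\Gamma_{\underline{\mathcal B}}\cong\Pi(\Gamma_{\mathcal B},\Theta)$, and $X$ acts faithfully on $\mathcal B$ if and only if $X$ acts faithfully on $\underline{\mathcal B}$.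
   Context: Graphs are finite, simple, undirected; an arc is an ordered pair of adjacent vertices. $X$-symmetric: $X$ acts preserving adjacency, transitively on vertices and arcs. For an $X$-invariant partition $\mathcal B$ of $V(\Gamma)$: $\Gamma_{\mathcal B}$ is the quotient graph on $\mathcal B$ ($B\sim C$ iff some vertex of $B$ is adjacent to some vertex of $C$); $\Gamma(C)=\bigcup_{\mathfrak u\in C}\Gamma(\mathfrak u)$; $\Gamma_{\mathcal B}(\mathfrak v)=\{C\in\mathcal B:\mathfrak v\in\Gamma(C)\}$ (a subset of the neighbourhood of the block containing $\mathfrak v$ in $\Gamma_{\mathcal B}$); $\Gamma$ is a multicover of $\Gamma_{\mathcal B}$ if $|\Gamma(C)\cap B|=|B|$ for adjacent $B,C$. $\mathcal G$ is the set of triples $(\Gamma,X,\mathcal B)$ with $\Gamma$ finite $X$-symmetric, $\mathcal B$ an $X$-invariant partition with $1<|B|<|V(\Gamma)|$, $val(\Gamma_{\mathcal B})\ge2$, $\Gamma$ not a multicover of $\Gamma_{\mathcal B}$. For $\mathfrak v\in B\in\mathcal B$, $B_{\mathfrak v}=B\cap\bigcap_{C\in\Gamma_{\mathcal B}(\mathfrak v)}\Gamma(C)$, and $\underline{\mathcal B}=\{B_{\mathfrak v}:B\in\mathcal B,\mathfrak v\in B\}$ (an $X$-invariant partition of $V(\Gamma)$); $\Gamma_{\underline{\mathcal B}}$ is the corresponding quotient graph. For a graph $\Sigma$ and $S\subseteq\Sigma(\tau)$ with $|S|=\kappa$, the $\kappa$-star is $\mathfrak s(\tau,S)=\{(\tau,\sigma):\sigma\in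 S\}$; $St^\kappa(\Sigma)$ is the set of $\kappa$-stars. A star $\mathfrak s(\tau,S)$ is symmetric if $X_\tau\cap X_S$ is transitive on $S$; a set of stars is $X$-symmetric if it is a single $X$-orbit containing a symmetric star. A $\kappa$-double star is a pair $(\mathfrak l,\mathfrak r)$ of $\kappa$-stars $\mathfrak l=\mathfrak s(\tau,L)$, $\mathfrak r=\mathfrak s(\sigma,R)$ with $\sigma\in L$, $\tau\in R$; $DSt^\kappa(\Sigma)$ is their set; $St(\Theta)=\{\mathfrak l,\mathfrak r:(\mathfrak l,\mathfrak r)\in\Theta\}$; an $X$-orbit $\Theta$ on $DSt^\kappa(\Sigma)$ is $X$-symmetric if $St(\Theta)$ is, and self-paired if $(\mathfrak l,\mathfrak r)\in\Theta\Rightarrow(\mathfrak r,\mathfrak l)\in\Theta$. $\Pi(\Sigma,\Theta)$ is the graph with vertex set $St(\Theta)$ in which $\mathfrak l\sim\mathfrak r$ iff $(\mathfrak l,\mathfrak r)\in\Theta$. *)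

(* Defs.v *)
From mathcomp Require Export all_boot.

Set Implicit Arguments.
Unset Strict Implicit.
Unset Printing Implicit Defensive.

(* The vertex set is a finite set inside a carrier type, so that quotients
   (carrier {set T}) and graphs of stars are graphs in the same sense, and one
   action on T induces the actions on blocks, arcs, stars and double stars. *)
Record graph (T : finType) := Graph { verts : {set T}; adj : rel T }.

Section Graphs.
Variable T : finType.
Implicit Types (G : graph T) (u v : T) (B C : {set T}) (P : {set {set T}}).

Definition simple_graph G : Prop :=
  [/\ symmetric (adj G), irreflexive (adj G) &
      forall u v, adj G u v -> (u \in verts G) && (v \in verts G)].

Definition arcs G : {set T * T} := [set a | adj G a.1 a.2].
Definition nbhd G v : {set T} := [set u | adj G v u].
Definition nbhds G C : {set T} := \bigcup_(u in C) nbhd G u.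

Definition quotient_graph G P : graph {set T} :=
  {| verts := P;
     adj := fun B C =>
       [&& B \in P, C \in P, B != C &
           [exists u in B, exists v in C, adj G u v]] |}.

Definition nbr_blocks G P v : {set {set T}} := [set C in P | v \in nbhds G C].

Definition multicover G P : Prop :=
  forall B C, adj (quotient_graph G P) B C -> #|nbhds G C :&: B| = #|B|.

Definition has_valency G (k : nat) : Prop :=
  forall v, v \in verts G -> #|nbhd G v| = k.

(* The cell B_v; meant for v in B in P. *)
Definition subblock G P B v : {set T} :=
  B :&: \bigcap_(C in nbr_blocks G P v) nbhds G C.

Definition refinement G P : {set {set T}} :=
  [set D | [exists B in P, exists v in B, D == subblock G P B v]].

End Graphs.

Definition isomorphic (T U : finType) (G : graph T) (H : graph U) : Prop :=
  exists f : T -> U,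
    [/\ {in verts G &, injective f}, f @: verts G = verts H &
        {in verts G &, forall u v, adj H (f u) (f v) = adj G u v}].

Section Actions.
Variable X : groupType.

(* Right actions of an arbitrary (possibly infinite) group, not assumed
   faithful. *)
Definition group_action (T : Type) (to : T -> X -> T) : Prop :=
  (forall v, to v 1%g = v) /\ (forall v x y, to v (x * y)%g = to (to v x) y).

Definition set_act (T : finType) (to : T -> X -> T) (A : {set T}) (x : X) :
  {set T} := [set to v x | v in A].

Definition pair_act (T : Type) (to : T -> X -> T) (a : T * T) (x : X) : T * T :=
  (to a.1 x, to a.2 x).

Definition transitive_on (T : finType) (to : T -> X -> T) (W : {set T}) : Prop :=
  {in W &, forall a b, exists x, to a x = b}.

Definition is_orbit (T : finType) (to : T -> X -> T) (O : {set T}) : Prop :=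
  exists a, forall b, b \in O <-> exists x, b = to a x.

Definition faithful_on (T : finType) (to : T -> X -> T) (W : {set T}) : Prop :=
  forall x, (forall w, w \in W -> to w x = w) -> x = 1%g.

Definition symmetric_graph (T : finType) (to : T -> X -> T) (G : graph T) : Prop :=
  [/\ forall v x, v \in verts G -> to v x \in verts G,
      forall u v x, adj G (to u x) (to v x) = adj G u v,
      transitive_on to (verts G) & transitive_on (pair_act to) (arcs G)].

Definition invariant_partition (T : finType) (to : T -> X -> T) (G : graph T)
  (P : {set {set T}}) : Prop :=
  partition P (verts G) /\ forall B x, B \in P -> set_act to B x \in P.

Definition in_calG (T : finType) (to : T -> X -> T) (G : graph T)
  (P : {set {set T}}) : Prop :=
  [/\ simple_graph G, group_action to, symmetric_graph to G &
      invariant_partition to G P] /\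
  [/\ forall B, B \in P -> 1 < #|B| < #|verts G|,
      exists2 k, 2 <= k & has_valency (quotient_graph G P) k &
      ~ multicover G P].

End Actions.

Section Stars.
Variable V : finType.
Implicit Types (S : graph V) (k : nat).

Definition star (t : V) (L : {set V}) : {set V * V} := [set (t, s) | s in L].

Definition stars S k : {set {set V * V}} :=
  [set l | [exists t in verts S, exists L : {set V},
     [&& L \subset nbhd S t, #|L| == k & l == star t L]]].

Definition double_stars S k : {set {set V * V} * {set V * V}} :=
  [set d | [exists t in verts S, exists s in verts S,
     exists L : {set V}, exists R : {set V},
     [&& L \subset nbhd S t, #|L| == k, R \subset nbhd S s, #|R| == k,
         s \in L, t \in R & d == (star t L, star s R)]]].

Definition stars_of (Th : {set {set V * V} * {set V * V}}) : {set {set V * V}} :=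
  [set d.1 | d in Th] :|: [set d.2 | d in Th].

Definition self_paired (Th : {set {set V * V} * {set V * V}}) : Prop :=
  forall l r, (l, r) \in Th -> (r, l) \in Th.

Definition Pi_graph (Th : {set {set V * V} * {set V * V}}) : graph {set V * V} :=
  {| verts := stars_of Th; adj := fun l r => (l, r) \in Th |}.

Variables (X : groupType) (to : V -> X -> V).

Definition star_act : {set V * V} -> X -> {set V * V} := set_act (pair_act to).

(* The common stabiliser of t and L is transitive on L. *)
Definition symmetric_star (t : V) (L : {set V}) : Prop :=
  {in L &, forall s1 s2,
     exists x, [/\ to t x = t, set_act to L x = L & to s1 x = s2]}.

Definition symmetric_star_orbit S k (Ss : {set {set V * V}}) : Prop :=
  [/\ Ss \subset stars S k, is_orbit star_act Ss &
      exists (t : V) (L : {set V}),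
                 [/\ t \in verts S, L \subset nbhd S t, star t L \in Ss &
                      symmetric_star t L]].

Definition symmetric_double_star_orbit S k
  (Th : {set {set V * V} * {set V * V}}) : Prop :=
  [/\ Th \subset double_stars S k, is_orbit (pair_act star_act) Th &
      symmetric_star_orbit S k (stars_of Th)].

End Stars.

Definition block_stars (T : finType) (G : graph T) (P : {set {set T}}) :
  {set {set {set T} * {set T}}} :=
  [set l | [exists B in P, exists v in B, l == star B (nbr_blocks G P v)]].

Definition block_double_stars (T : finType) (G : graph T) (P : {set {set T}}) :
  {set {set {set T} * {set T}} * {set {set T} * {set T}}} :=
  [set d | [exists B in P, exists v in B, exists C in P, exists u in C,
     adj G v u &&
     (d == (star B (nbr_blocks G P v), star C (nbr_blocks G P u)))]].

(* Main.v *)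
Require Import Defs.

Set Implicit Arguments.
Unset Strict Implicit.
Unset Printing Implicit Defensive.

(* Write [s(v)] for the star at the block of [v] whose leaves are the blocks
   adjacent to [v].  Arc-transitivity and the presence of an edge between two
   distinct blocks force every edge to join distinct blocks and every vertex to
   have a neighbour; since [v |-> s(v)] commutes with the actions, the vertex
   and arc orbits of [G] become the orbits of stars and of double stars, and the
   stabiliser of [v], which is transitive on the neighbours of [v], makes [s(v)]
   symmetric.  The cell of [v] consists of the vertices [w] of the same block
   with [nbr_blocks v \subset nbr_blocks w]; all these sets having the same
   size, the cells are the fibres of [s], which gives the isomorphism. *)

(** * Group actions and the actions they induce on sets *)

Section GroupActions.
Variables (X : groupType) (T : finType) (to : T -> X -> T).
Hypothesis toA : group_action to.

Lemma group_actionK x : cancel (to^~ x) (to^~ x^-1%g).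
Proof. by move=> v; rewrite -toA.2 mulgV toA.1. Qed.

Lemma group_action_inj x : injective (to^~ x).
Proof. exact: can_inj (group_actionK x). Qed.

(** Lets the other lemmas of this section be applied one level up, to the action on blocks and on
    sets of blocks. *)
Lemma set_act_group_action : group_action (set_act to).
Proof.
split=> [A | A x y]; rewrite /set_act.
  by under eq_imset => v do rewrite toA.1; rewrite imset_id.
by rewrite -imset_comp; apply: eq_imset => v /=; rewrite toA.2.
Qed.

Lemma mem_set_act A v x : (to v x \in set_act to A x) = (v \in A).
Proof. exact: mem_imset (@group_action_inj x). Qed.

Lemma card_set_act A x : #|set_act to A x| = #|A|.
Proof. exact: card_imset (@group_action_inj x). Qed.

End GroupActions.

(** * Stars as sets of arcs *)

Section StarTheory.
Variable V : finType.
Implicit Types (s t : V) (L M : {set V}).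

Lemma mem_star t L s u : ((s, u) \in star t L) = (s == t) && (u \in L).
Proof.
apply/imsetP/andP => [[w wL [-> ->]] | [/eqP-> uL]]; first by rewrite eqxx.
by exists u.
Qed.

(** An empty star is the empty set of arcs and forgets its centre; any single leaf of [L] recovers
    it. *)
Lemma star_inj s t L M :
  L != set0 -> star s L = star t M -> s = t /\ L = M.
Proof.
case/set0Pn => u uL eqLM.
have /andP[/eqP st _] : (s == t) && (u \in M) by rewrite -mem_star -eqLM mem_star eqxx.
split=> //; apply/setP => w.
by have := mem_star s L s w; rewrite eqLM mem_star st eqxx /= => ->.
Qed.

Lemma star_act_star (X : groupType) (to : V -> X -> V) t L x :
  star_act to (star t L) x = star (to t x) (set_act to L x).
Proof. by rewrite /star_act /set_act /star -!imset_comp. Qed.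

End StarTheory.

Section BlockStars.
Variables (T : finType) (X : groupType) (to : T -> X -> T).
Variables (G : graph T) (P : {set {set T}}).

(** Indexing by the vertex alone, with [pblock P v] in place of a separately quantified block, turns
    the stars, cells and double stars of the statement into images of [verts G] and [arcs G]. *)
Let vstar v := star (pblock P v) (nbr_blocks G P v).
Let cell v := subblock G P (pblock P v) v.

(** * Blocks, stars and cells, before the action is used *)

Section Partition.
Hypothesis partP : partition P (verts G).

Lemma pblock_of B v : B \in P -> v \in B -> pblock P v = B.
Proof. by case/and3P: partP => _ tI _; apply: def_pblock. Qed.

Lemma block_verts B v : B \in P -> v \in B -> v \in verts G.
Proof. by move=> BP vB; rewrite -(cover_partition partP); apply/bigcupP; exists B. Qed.

Lemma mem_own_block v : v \in verts G -> v \in pblock P v.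
Proof. by rewrite mem_pblock (cover_partition partP). Qed.

Lemma own_block_mem v : v \in verts G -> pblock P v \in P.
Proof. by move=> vG; rewrite pblock_mem // (cover_partition partP). Qed.

Lemma block_starsE : block_stars G P = vstar @: verts G.
Proof.
apply/setP=> l; rewrite inE; apply/exists_inP/imsetP.
  case=> B BP /exists_inP[v vB /eqP->]; exists v; first exact: block_verts vB.
  by rewrite /vstar (pblock_of BP vB).
case=> v vG ->; exists (pblock P v); first exact: own_block_mem.
by apply/exists_inP; exists v; first exact: mem_own_block.
Qed.

Lemma refinementE : refinement G P = cell @: verts G.
Proof.
apply/setP=> D; rewrite inE; apply/exists_inP/imsetP.
  case=> B BP /exists_inP[v vB /eqP->]; exists v; first exact: block_verts vB.
  by rewrite /cell (pblock_of BP vB).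
case=> v vG ->; exists (pblock P v); first exact: own_block_mem.
by apply/exists_inP; exists v; first exact: mem_own_block.
Qed.

Hypothesis simpG : simple_graph G.

Lemma block_double_starsE :
  block_double_stars G P = [set (vstar a.1, vstar a.2) | a in arcs G].
Proof.
case: simpG => _ _ adjG.
apply/setP=> d; rewrite inE; apply/exists_inP/imsetP.
  case=> B BP /exists_inP[v vB /exists_inP[C CP /exists_inP[u uC /andP[vu /eqP->]]]].
  by exists (v, u); rewrite ?inE // /vstar (pblock_of BP vB) (pblock_of CP uC).
case=> -[v u]; rewrite inE /= => vu ->; have /andP[vG uG] := adjG _ _ vu.
exists (pblock P v); first exact: own_block_mem.
apply/exists_inP; exists v; first exact: mem_own_block.
apply/exists_inP; exists (pblock P u); first exact: own_block_mem.
by apply/exists_inP; exists u; [exact: mem_own_block | rewrite vu eqxx].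
Qed.

Lemma mem_nbr_blocks v C :
  reflect (exists u, [/\ u \in verts G, adj G v u & C = pblock P u])
          (C \in nbr_blocks G P v).
Proof.
case: simpG => symG _ adjG; rewrite inE; apply: (iffP andP).
  case=> CP /bigcupP[u uC]; rewrite inE => uv; exists u.
  by rewrite symG (pblock_of CP uC) (block_verts CP uC).
case=> u [uG vu ->]; split; first exact: own_block_mem.
by apply/bigcupP; exists u; [exact: mem_own_block | rewrite inE symG].
Qed.

(** Lying in [nbhds G C] for a block [C] means having [C] as a neighbouring block. Only an inclusion
    is available here; equality needs the constant cardinality that transitivity provides. *)
Lemma mem_cell v w : v \in verts G -> w \in verts G ->
  (w \in cell v) =
  (pblock P w == pblock P v) && (nbr_blocks G P v \subset nbr_blocks G P w).
Proof.
move=> vG wG; rewrite inE; congr (_ && _).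
  apply/idP/eqP => [|<-]; last exact: mem_own_block.
  by move=> wv; apply: pblock_of => //; apply: own_block_mem.
apply/bigcapP/subsetP => sub C Cv; last by have := sub C Cv; rewrite inE => /andP[].
by rewrite inE (sub C Cv) andbT; move: Cv; rewrite inE => /andP[].
Qed.

Lemma cell_verts v w : v \in verts G -> w \in cell v -> w \in verts G.
Proof.
move=> vG; rewrite inE => /andP[wB _].
by apply: block_verts wB; apply: own_block_mem.
Qed.

End Partition.

(** * Consequences of symmetry: edges between blocks, equivariance, cells *)

Hypothesis hG : in_calG to G P.

Let simpG : simple_graph G. Proof. by case: hG => -[]. Qed.
Let toA : group_action to. Proof. by case: hG => -[]. Qed.
Let symG : symmetric_graph to G. Proof. by case: hG => -[]. Qed.
Let partP : partition P (verts G). Proof. by case: hG => -[_ _ _ []]. Qed.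
Let invP B x : B \in P -> set_act to B x \in P.
Proof. by case: hG => -[_ _ _ [_ h]] _; apply: h. Qed.

Lemma verts_act v x : v \in verts G -> to v x \in verts G.
Proof. by case: symG => h _ _ _; apply: h. Qed.

Lemma adj_act u v x : adj G (to u x) (to v x) = adj G u v.
Proof. by case: symG. Qed.

Lemma verts_transitive : transitive_on to (verts G).
Proof. by case: symG. Qed.

Lemma arcs_transitive u v u' v' :
  adj G u v -> adj G u' v' -> exists x, to u x = u' /\ to v x = v'.
Proof.
case: symG => _ _ _ tr uv uv'.
have [||x [<- <-]] := tr (u, v) (u', v'); rewrite ?inE //.
by exists x.
Qed.

Lemma pblock_act v x : v \in verts G -> pblock P (to v x) = set_act to (pblock P v) x.
Proof.
move=> vG; apply: (pblock_of partP); first by apply/invP/own_block_mem.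
by rewrite mem_set_act //; apply: mem_own_block.
Qed.

(* A graph without edges between distinct blocks would vacuously be a
   multicover. *)
Lemma quotient_edge : exists u v, adj G u v /\ pblock P u != pblock P v.
Proof.
case: hG => _ [_ _ nmc].
have [/existsP[u /existsP[v /andP[uv nuv]]]|none] :=
  boolP [exists u, exists v, adj G u v && (pblock P u != pblock P v)].
  by exists u, v.
case: nmc => B C /and4P[BP CP nBC /exists_inP[u uB /exists_inP[v vC uv]]].
case/existsP: none; exists u; apply/existsP; exists v.
by rewrite uv (pblock_of partP BP uB) (pblock_of partP CP vC).
Qed.

Lemma adj_neq_pblock u v : adj G u v -> pblock P u != pblock P v.
Proof.
have [u0 [v0 [uv0 neq0]]] := quotient_edge => uv.
have [x [<- <-]] := arcs_transitive uv0 uv.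
case: simpG => _ _ adjG; have /andP[uG vG] := adjG _ _ uv0.
(* The element carrying the known edge to the given one permutes the blocks injectively, so distinct
   blocks stay distinct. *)
by rewrite !pblock_act // (inj_eq (group_action_inj (set_act_group_action toA) (x := x))).
Qed.

Lemma exists_nbr v : v \in verts G -> exists u, adj G v u.
Proof.
have [u0 [v0 [uv0 _]]] := quotient_edge => vG.
case: simpG => _ _ adjG; have /andP[uG _] := adjG _ _ uv0.
by have [x <-] := verts_transitive uG vG; exists (to v0 x); rewrite adj_act.
Qed.

Lemma nbr_blocks_neq0 v : v \in verts G -> nbr_blocks G P v != set0.
Proof.
case: simpG => _ _ adjG vG; have [u vu] := exists_nbr vG; apply/set0Pn.
have /andP[_ uG] := adjG _ _ vu.
by exists (pblock P u); apply/(mem_nbr_blocks partP simpG); exists u.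
Qed.

Lemma nbr_blocks_act v x :
  nbr_blocks G P (to v x) = set_act (set_act to) (nbr_blocks G P v) x.
Proof.
apply/setP=> C; apply/(mem_nbr_blocks partP simpG)/imsetP.
  case=> u [uG vu ->]; exists (pblock P (to u x^-1%g)).
    apply/(mem_nbr_blocks partP simpG); exists (to u x^-1%g); split=> //.
      exact: verts_act.
    by rewrite -(adj_act _ _ x) -toA.2 mulVg toA.1.
  by rewrite -pblock_act ?verts_act // -toA.2 mulVg toA.1.
case=> _ /(mem_nbr_blocks partP simpG)[u [uG vu ->]] ->.
by exists (to u x); rewrite adj_act -pblock_act // verts_act.
Qed.

Lemma card_nbr_blocks v w : v \in verts G -> w \in verts G ->
  #|nbr_blocks G P v| = #|nbr_blocks G P w|.
Proof.
move=> vG wG; have [x <-] := verts_transitive vG wG.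
by rewrite nbr_blocks_act card_set_act //; apply: set_act_group_action.
Qed.

Lemma vstar_act v x : v \in verts G -> star_act (set_act to) (vstar v) x = vstar (to v x).
Proof. by move=> vG; rewrite star_act_star -pblock_act // -nbr_blocks_act. Qed.

Lemma nbr_blocks_sub v : v \in verts G ->
  nbr_blocks G P v \subset nbhd (quotient_graph G P) (pblock P v).
Proof.
move=> vG; apply/subsetP=> _ /(mem_nbr_blocks partP simpG)[u [uG vu ->]].
rewrite inE /= !own_block_mem // adj_neq_pblock //=.
apply/exists_inP; exists v; first exact: mem_own_block.
by apply/exists_inP; exists u; first exact: mem_own_block.
Qed.

(** Replaces the one-sided condition of [mem_cell] by an equality, so that sharing a cell becomes an
    equivalence relation. The converse reads the block and its neighbours off a nonempty star. *)
Lemma mem_cell_vstar v w : v \in verts G -> w \in verts G ->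
  (w \in cell v) = (vstar w == vstar v).
Proof.
move=> vG wG; rewrite mem_cell //; apply/andP/eqP.
  move=> [/eqP eqB sub]; rewrite /vstar eqB; congr star; apply/esym/eqP.
  by rewrite eqEcard sub (card_nbr_blocks wG vG) leqnn.
by move=> /(star_inj (nbr_blocks_neq0 wG))[-> ->].
Qed.

Lemma mem_cell_id v : v \in verts G -> v \in cell v.
Proof. by move=> vG; rewrite mem_cell_vstar. Qed.

Lemma eq_cell_vstar v w : v \in verts G -> w \in verts G ->
  (cell v == cell w) = (vstar v == vstar w).
Proof.
move=> vG wG; apply/eqP/eqP => [eqC | eqS].
  by apply/eqP; rewrite -mem_cell_vstar // -eqC mem_cell_id.
(* The carrier may have points outside [verts G], where [mem_cell_vstar] says nothing; no cell
   contains them. *)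
apply/setP=> u; have [uG|nuG] := boolP (u \in verts G).
  by rewrite !mem_cell_vstar // eqS.
by rewrite !(contraNF (cell_verts partP _)).
Qed.

Lemma cell_act v x : v \in verts G -> set_act to (cell v) x = cell (to v x).
Proof.
have sub y w : w \in verts G -> set_act to (cell w) y \subset cell (to w y).
  move=> wG; apply/subsetP=> _ /imsetP[u uw ->]; have uG := cell_verts partP wG uw.
  move: uw; rewrite !mem_cell_vstar ?verts_act // => /eqP eqS.
  by rewrite -!vstar_act // eqS.
move=> vG; apply/eqP; rewrite eqEsubset sub //=.
(* The reverse inclusion is [sub] for the inverse of [x] at the vertex [to v x]. *)
apply/subsetP=> u uv; rewrite -[u]toA.1 -(mulVg x) toA.2 mem_set_act //.
rewrite -[v]toA.1 -(mulgV x) toA.2.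
by apply: (subsetP (sub _ _ (verts_act x vG))); rewrite mem_set_act.
Qed.

(** * The orbits of stars and double stars *)

Lemma block_stars_symmetric v0 : v0 \in verts G ->
  symmetric_star_orbit (set_act to) (quotient_graph G P) #|nbr_blocks G P v0|
    (block_stars G P).
Proof.
move=> v0G; rewrite block_starsE //; split.
- apply/subsetP=> _ /imsetP[v vG ->]; rewrite inE.
  apply/exists_inP; exists (pblock P v); first exact: own_block_mem.
  apply/existsP; exists (nbr_blocks G P v).
  by rewrite nbr_blocks_sub // (card_nbr_blocks vG v0G) !eqxx.
- exists (vstar v0) => l; split=> [/imsetP[v vG ->] | [x ->]].
    by have [x <-] := verts_transitive v0G vG; exists x; rewrite vstar_act.
  by rewrite vstar_act // imset_f // verts_act.
exists (pblock P v0), (nbr_blocks G P v0); split.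
- exact: own_block_mem.
- exact: nbr_blocks_sub.
- exact: imset_f.
move=> C1 C2 /(mem_nbr_blocks partP simpG)[u1 [u1G vu1 ->]].
move=> /(mem_nbr_blocks partP simpG)[u2 [u2G vu2 ->]].
(* Both arcs start at [v0], so [x] fixes [v0] and hence its block and its set of neighbouring
   blocks. *)
have [x [v0x u1x]] := arcs_transitive vu1 vu2; exists x.
by rewrite -nbr_blocks_act -!pblock_act // v0x u1x.
Qed.

Lemma stars_of_block_double_stars : stars_of (block_double_stars G P) = block_stars G P.
Proof.
rewrite block_double_starsE // block_starsE //; case: simpG => _ _ adjG.
apply/setP=> l; rewrite inE; apply/orP/imsetP.
  case=> /imsetP[d /imsetP[[v u] vu ->] ->]; move: vu; rewrite inE => /adjG/andP[vG uG].
    by exists v.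
  by exists u.
(* Left components already give every star, since each vertex is the tail of an arc. *)
case=> v vG ->; left; have [u vu] := exists_nbr vG.
apply/imsetP; exists (vstar v, vstar u) => //.
by apply/imsetP; exists (v, u); rewrite ?inE.
Qed.

Lemma block_double_stars_symmetric v0 : v0 \in verts G ->
  symmetric_double_star_orbit (set_act to) (quotient_graph G P)
    #|nbr_blocks G P v0| (block_double_stars G P).
Proof.
move=> v0G; split; last 1 first.
- by rewrite stars_of_block_double_stars; apply: block_stars_symmetric.
- case: simpG => adjC _ adjG; rewrite block_double_starsE //.
  apply/subsetP=> _ /imsetP[[v u] vu ->]; move: vu; rewrite !inE /= => vu.
  have /andP[vG uG] := adjG _ _ vu.
  apply/exists_inP; exists (pblock P v); first exact: own_block_mem.
  apply/exists_inP; exists (pblock P u); first exact: own_block_mem.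
  apply/existsP; exists (nbr_blocks G P v); apply/existsP; exists (nbr_blocks G P u).
  rewrite !nbr_blocks_sub // (card_nbr_blocks vG v0G) (card_nbr_blocks uG v0G).
  rewrite !eqxx /= andbT; apply/andP; split; apply/(mem_nbr_blocks partP simpG).
    by exists u.
  by exists v; rewrite adjC.
case: simpG => _ _ adjG; rewrite block_double_starsE //.
have [u vu] := exists_nbr v0G; have /andP[_ uG] := adjG _ _ vu.
exists (vstar v0, vstar u) => d; split.
  case/imsetP=> -[v' u']; rewrite inE /= => vu' ->.
  by have [x [<- <-]] := arcs_transitive vu vu'; exists x; rewrite /pair_act /= !vstar_act.
case=> x ->; rewrite /pair_act /= !vstar_act //.
by apply/imsetP; exists (to v0 x, to u x); rewrite ?inE //= adj_act.
Qed.

Lemma block_double_stars_self_paired : self_paired (block_double_stars G P).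
Proof.
case: simpG => adjC _ _; rewrite block_double_starsE // => l r.
case/imsetP=> -[v u]; rewrite inE /= => vu [-> ->].
by apply/imsetP; exists (u, v); rewrite ?inE //= adjC.
Qed.

(** * The isomorphism and the comparison of kernels *)

Lemma refinement_Pi_isomorphic :
  isomorphic (quotient_graph G (refinement G P)) (Pi_graph (block_double_stars G P)).
Proof.
case: (simpG) => _ _ adjG.
(* The choice of [v] is immaterial because [vstar] is constant on cells. The default is never
   reached on a cell, which contains the vertex defining it. *)
pose f (D : {set T}) := if [pick v in D] is Some v then vstar v else set0.
have fE v : v \in verts G -> f (cell v) = vstar v.
  move=> vG; rewrite /f; case: pickP => [w wv|/(_ v)]; last by rewrite mem_cell_id.
  by apply/eqP; rewrite -mem_cell_vstar // (cell_verts partP vG wv).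
exists f; split=> /=.
- rewrite refinementE // => _ _ /imsetP[v vG ->] /imsetP[w wG ->].
  by rewrite !fE // => /eqP; rewrite -eq_cell_vstar // => /eqP.
- rewrite stars_of_block_double_stars block_starsE // refinementE //.
  by rewrite -imset_comp; apply: eq_in_imset => v vG /=; rewrite fE.
rewrite refinementE // => _ _ /imsetP[v vG ->] /imsetP[w wG ->].
rewrite !fE // !imset_f //= block_double_starsE //.
apply/imsetP/andP.
  case=> -[v' w']; rewrite inE /= => vw [eqv eqw]; have /andP[vG' wG'] := adjG _ _ vw.
  split.
    (* Adjacency in the quotient requires distinct cells: equal stars would have the same centre,
       but the ends of an arc lie in distinct blocks. *)
    rewrite eq_cell_vstar // eqv eqw; apply: contra (adj_neq_pblock vw).
    by case/eqP/(star_inj (nbr_blocks_neq0 vG')) => ->.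
  apply/exists_inP; exists v'; first by rewrite mem_cell_vstar // eqv.
  by apply/exists_inP; exists w'; first by rewrite mem_cell_vstar // eqw.
case=> _ /exists_inP[v' vv /exists_inP[w' ww vw]]; exists (v', w'); first by rewrite inE.
have /andP[vG' wG'] := adjG _ _ vw.
by move: vv ww; rewrite !mem_cell_vstar // => /eqP-> /eqP->.
Qed.

(** The two actions have the same kernel. An element fixing every cell fixes every star, hence its
    centre, and every block is such a centre. An element fixing every block fixes each centre and
    each set of neighbouring blocks, hence every star and every cell. *)
Lemma faithful_on_refinement :
  faithful_on (set_act to) P <-> faithful_on (set_act to) (refinement G P).
Proof.
rewrite refinementE //; split=> faith x fix_x; apply: faith;
  [move=> B BP | move=> _ /imsetP[v vG ->]].
  have /set0Pn[v vB] : B != set0.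
    by apply: contraTneq BP => ->; case/and3P: partP.
  have vG := block_verts partP BP vB.
  have := fix_x _ (imset_f cell vG); rewrite cell_act // => /eqP.
  rewrite eq_cell_vstar ?verts_act // => /eqP/star_inj[].
    by rewrite nbr_blocks_neq0 ?verts_act.
  by rewrite pblock_act // (pblock_of partP BP vB).
rewrite cell_act //; apply/eqP; rewrite eq_cell_vstar ?verts_act // /vstar.
rewrite pblock_act // fix_x ?own_block_mem // nbr_blocks_act.
rewrite /(set_act (set_act to)) (eq_in_imset (g := id)) ?imset_id // => C.
by rewrite inE => /andP[CP _]; apply: fix_x.
Qed.

End BlockStars.

Theorem theorem3p7 (T : finType) (X : groupType) (to : T -> X -> T)
    (G : graph T) (P : {set {set T}}) (hG : in_calG to G P) :
  let GP := quotient_graph G P in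
  let toP := set_act to in
  let calS := block_stars G P in
  let Theta := block_double_stars G P in
  (exists r : nat,
     [/\ forall v, v \in verts G -> #|nbr_blocks G P v| = r,
         symmetric_star_orbit toP GP r calS &
         symmetric_double_star_orbit toP GP r Theta]) /\
  [/\ self_paired Theta,
      stars_of Theta = calS,
      isomorphic (quotient_graph G (refinement G P)) (Pi_graph Theta) &
      (faithful_on toP P <-> faithful_on toP (refinement G P))].
Proof.
move=> GP toP calS Theta; split; last first.
  split.
  - exact: block_double_stars_self_paired hG.
  - exact: stars_of_block_double_stars hG.
  - exact: refinement_Pi_isomorphic hG.
  exact: faithful_on_refinement hG.
(* A vertex is needed to name [r]; an end of this edge serves. *)
have [v [u [vu _]]] := quotient_edge hG.
have /andP[vG _] : (v \in verts G) && (u \in verts G).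
  by case: hG => -[[_ _ adjG] _ _ _] _; apply: adjG.
exists #|nbr_blocks G P v|; split.
- by move=> w wG; apply: (card_nbr_blocks hG).
- exact: block_stars_symmetric.
exact: block_double_stars_symmetric.
Qed.
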